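(* Assume Lasry--Lions monotonicity: $\langle J(\mu,\cdot)-J(\nu,\cdot),\mu-\nu\rangle\ge0$ for all $\mu,\nu\in\mathcal P(\Omega)$. Let $\varepsilon\ge0$ and suppose that $\mu^\varepsilon\in\mathcal P(\Omega)$ satisfies the $\varepsilon$-variational inequality $$\langle J(\mu^\varepsilon,\cdot),\eta-\mu^\varepsilon\rangle\ge-\varepsilon\qquad\forall\,\eta\in\mathcal P(\Omega).$$ Then $\mu^\varepsilon$ satisfies the $\varepsilon$-Minty variational inequality $$\langle J(\eta,\cdot),\eta-\mu^\varepsilon\rangle\ge-\varepsilon\qquad\forall\,\eta\in\mathcal P(\Omega).$$
   Context: $\Omega\subset\mathbb R^d$ is a nonempty compact set, $\mathcal P(\Omega)$ is the set of Borel probability measures on $\Omega$, and $J:\mathcal P(\Omega)\times\Omega\to\mathbb R$ is such that $J(\mu,\cdot)\in C(\Omega)$ for every $\mu\in\mathcal P(\Omega)$. For $f\in C(\Omega)$ and a finite signed measure $\xi$, $\langle f,\xi\rangle:=\int_\Omega f\,d\xi$. *)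

(* Defs.v *)
From HB Require Import structures.
From mathcomp Require Import all_boot all_order all_algebra.
From mathcomp Require Import all_classical all_reals all_analysis.

Set Implicit Arguments.
Unset Strict Implicit.
Unset Printing Implicit Defensive.

Import Order.TTheory GRing.Theory Num.Theory.
Import numFieldNormedType.Exports.

Local Open Scope classical_set_scope.
Local Open Scope ring_scope.

(* The points of a nonempty set [Omega], with the topology induced by the
   ambient space and the Borel sigma-algebra of that topology.  The proof of
   nonemptiness is a parameter because measurable types are pointed. *)
Definition subspace_of (X : topologicalType) (Omega : set X)
  (Omega0 : Omega !=set0) : Type := set_type Omega.

Section subspace_of.
Context (X : topologicalType) (Omega : set X) (Omega0 : Omega !=set0).
Local Notation S := (subspace_of Omega0).

Definition subspace_of_point : S :=
  SigSub (mem_set (projT2 (cid Omega0))).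

HB.instance Definition _ := Topological.copy S (set_type Omega).
HB.instance Definition _ := isPointed.Build S subspace_of_point.
HB.instance Definition _ :=
  Measurable.copy S (g_sigma_algebraType (@open S)).

End subspace_of.

Section pairing.
Context d (T : measurableType d) (R : realType).

(* Integral against a finite signed measure through its Jordan decomposition
   [xi = xi^+ - xi^-], which does not depend on the Hahn decomposition chosen
   (see [Hahn_decomposition_uniq]). *)
Definition pairing (f : T -> R) (xi : {charge set T -> \bar R}) : R :=
  let hahnP := cid (Hahn_decomposition xi) in
  let hahnN := projT2 (cid (projT2 hahnP)) in
  \int[jordan_pos hahnN]_x f x - \int[jordan_neg hahnN]_x f x.

Definition prob_sub (mu nu : probability T R) : {charge set T -> \bar R} :=
  cadd (charge_of_finite_measure mu) (copp (charge_of_finite_measure nu)).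

Definition lasry_lions_monotone (J : probability T R -> T -> R) : Prop :=
  forall mu nu, 0 <= pairing (J mu \- J nu) (prob_sub mu nu).

Definition eps_variational_inequality (J : probability T R -> T -> R)
    (eps : R) (mu : probability T R) : Prop :=
  forall eta : probability T R, - eps <= pairing (J mu) (prob_sub eta mu).

Definition eps_minty_variational_inequality (J : probability T R -> T -> R)
    (eps : R) (mu : probability T R) : Prop :=
  forall eta : probability T R, - eps <= pairing (J eta) (prob_sub eta mu).

End pairing.

(* Main.v *)
Require Import Defs.
From mathcomp Require Import all_boot all_order all_algebra.
From mathcomp Require Import all_classical all_reals all_analysis.
Import Order.TTheory GRing.Theory Num.Theory.
Import numFieldNormedType.Exports.

Local Open Scope classical_set_scope.
Local Open Scope ring_scope.

(** Minty's argument: testing monotonicity on the pair [eta, mu_eps] and the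
    variational inequality at [eta] involves the same signed measure
    [xi := eta - mu_eps], so that
      [<J eta, xi> = <J eta - J mu_eps, xi> + <J mu_eps, xi> >= 0 - eps].
    The one analytic point is the splitting of the pairing, [pairingB]: the
    pairing is made of two real-valued integrals, which are additive
    only on integrable functions.  Each [J mu] is integrable against both
    Jordan parts of [xi] because these are finite measures and a continuous
    function on a compact set is Borel measurable and bounded. *)

(** The sigma-algebra of the domain is generated by its open sets, and that of
    the real line by the bounded open intervals, whose preimages are open. *)
Lemma subspace_continuous_measurable {R : realType} {X : topologicalType}
    {Omega : set X} {Omega0 : Omega !=set0} {f : subspace_of Omega0 -> R} :
  continuous f -> measurable_fun setT f.
Proof.
move=> /continuousP cf.
apply: (measurability _ (measurable_realfun.RGenOpens.measurableE R)).
move=> _ [_ [a [b ->] <-]]; rewrite setTI.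
by apply: sub_sigma_algebra; apply: cf; apply: interval_open.
Qed.

(** Compactness is a property of [Omega] inside [X] whereas [f] lives on the
    subtype; the extension [valL f] of [f] to [X] bridges the two, since it is
    continuous within [Omega] and its image of [Omega] is the range of [f]. *)
Lemma subspace_compact_bounded {R : realType} {X : topologicalType}
    {Omega : set X} {Omega0 : Omega !=set0} {f : subspace_of Omega0 -> R} :
  compact Omega -> continuous f -> [bounded f x | x in setT].
Proof.
move=> cO /(@subspace_valL_continuousP _ Omega R f) cf.
have /compact_bounded := continuous_compact cf cO.
rewrite /bounded_set /bounded_near; apply: filterS => M fM x _; apply: fM.
exists (set_val x); first exact: set_valP.
by have /(congr1 (@^~ x)) := valLK point f.
Qed.

(** The Hahn decomposition chosen by [pairing] depends on [xi] only, so both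
    sides integrate against the same two Jordan parts; these are finite, which
    makes bounded measurable functions integrable. *)
Lemma pairingB {d} {T : measurableType d} {R : realType} {f g : T -> R}
    {xi : {charge set T -> \bar R}} :
  measurable_fun setT f -> [bounded f x | x in setT] ->
  measurable_fun setT g -> [bounded g x | x in setT] ->
  pairing (f \- g) xi = pairing f xi - pairing g xi.
Proof.
move=> mf bf mg bg; rewrite /pairing.
set P := jordan_pos _; set N := jordan_neg _.
have integrable_bounded (m : {finite_measure set T -> \bar R}) (h : T -> R) :
    measurable_fun setT h -> [bounded h x | x in setT] ->
    m.-integrable setT (EFin \o h).
  move=> mh bh; apply: measurable_bounded_integrable => //.
  by rewrite -ge0_fin_numE// fin_num_measure.
rewrite !RintegralB//; try exact: integrable_bounded.
by rewrite !opprB addrACA [RHS]addrACA; congr (_ + _); rewrite addrC.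
Qed.

Theorem proposition3p4 (R : realType) (d : nat) (Omega : set 'rV[R]_d)
    (Omega0 : Omega !=set0) (Omega_compact : compact Omega)
    (J : probability (subspace_of Omega0) R -> subspace_of Omega0 -> R)
    (J_continuous : forall mu, continuous (J mu))
    (J_monotone : lasry_lions_monotone J)
    (eps : R) (eps_ge0 : 0 <= eps)
    (mu_eps : probability (subspace_of Omega0) R)
    (mu_eps_vi : eps_variational_inequality J eps mu_eps) :
  eps_minty_variational_inequality J eps mu_eps.
Proof.
move=> eta; apply: le_trans (mu_eps_vi eta) _.
have := J_monotone eta mu_eps.
have mJ mu := subspace_continuous_measurable (J_continuous mu).
have bJ mu := subspace_compact_bounded Omega_compact (J_continuous mu).
by rewrite pairingB// subr_ge0.
Qed.
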